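(* For all $n\ge 1$ and $j\ge 2$, the number of permutations $\sigma\in S_n(231)$ with $\mathrm{des}(\sigma)=j$ and $\mathrm{maxdrop}(\sigma)=j-1$ equals $(2j-3)\binom{n+j-2}{2j}$. Consequently, the number of permutations $\sigma\in S_n(231)$ with $\mathrm{des}(\sigma)=j$ and $\mathrm{maxdrop}(\sigma)\le j-2$ equals $$\frac{1}{n}\binom{n}{j}\binom{n}{j+1}-\binom{n+j-1}{2j}-(2j-3)\binom{n+j-2}{2j}.$$
   Context: For a permutation $\sigma=\sigma_1\cdots\sigma_n$ of $[n]$, $\mathrm{des}(\sigma)$ is the number of $i\in[n-1]$ with $\sigma_i>\sigma_{i+1}$, and $\mathrm{maxdrop}(\sigma)=\max\{i-\sigma_i : i\in[n]\}$. $S_n(231)$ is the set of permutations of $[n]$ with no indices $a<b<c$ such that $\sigma_c<\sigma_a<\sigma_b$. *)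

(* Defs.v *)
From mathcomp Require Export all_boot all_fingroup all_algebra.

Set Implicit Arguments.
Unset Strict Implicit.
Unset Printing Implicit Defensive.

(* A permutation of {1, ..., n} is represented by s : 'S_n acting on
   {0, ..., n-1}; shifting both positions and values by one changes none of the
   notions below. *)

Definition avoids231 n (s : 'S_n) : bool :=
  ~~ [exists a : 'I_n, exists b : 'I_n, exists c : 'I_n,
       [&& a < b, b < c, s c < s a & s a < s b]].

(* The witness i' is the position following i, so the last position is never
   counted. *)
Definition des n (s : 'S_n) : nat :=
  #|[set i : 'I_n | [exists i' : 'I_n, (i' == i.+1 :> nat) && (s i' < s i)]]|.

(* Subtraction is truncated at 0. For n > 0 this does not affect the maximum:
   the drop at the last position is never negative. *)
Definition maxdrop n (s : 'S_n) : nat := \max_(i < n) (i - s i).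

(* Main.v *)
(* Splitting a 231-avoiding permutation at its maximum gives two 231-avoiding
   blocks l and r, with all values of l below those of r. If r is empty, des and
   maxdrop are those of l; otherwise des = des l + des r + 1 and
   maxdrop = max (maxdrop l) (maxdrop r + 1). Hence maxdrop <= des, and equality
   (or a defect of one) leaves only a few possibilities for the defects of l and r.
   The resulting recurrences are solved by binomial coefficients, by Pascal's rule
   and the Vandermonde convolution. The distribution of des is obtained from a
   linear recurrence for the coefficients of the powers of its generating
   function, whose closed form is the one given by Lagrange inversion. *)

Require Import Defs.
From mathcomp Require Import zify ring.

Set Implicit Arguments.
Unset Strict Implicit.
Unset Printing Implicit Defensive.

Import GRing.Theory Num.Theory.

(** * Permutations as words: statistics and 231-avoidance *)

Fixpoint des_from (x : nat) (w : seq nat) : nat :=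
  if w is y :: w' then (y < x) + des_from y w' else 0.

(** [p] is the position of the first letter, just as [x] in [des_from] is the letter before it. With
    these parameters both statistics can be evaluated on the pieces of a concatenation. *)
Fixpoint maxdrop_from (p : nat) (w : seq nat) : nat :=
  if w is y :: w' then maxn (p - y) (maxdrop_from p.+1 w') else 0.

(* No letter is below the initial letter 0, so it creates no descent. *)
Notation wdes := (des_from 0).
Notation wmaxdrop := (maxdrop_from 0).

Definition avoids231_word (w : seq nat) : bool :=
  ~~ [exists a : 'I_(size w), exists b : 'I_(size w), exists c : 'I_(size w),
       [&& a < b, b < c, nth 0 w c < nth 0 w a & nth 0 w a < nth 0 w b]].

Definition words231 (n : nat) : seq (seq nat) :=
  [seq w <- permutations (iota 0 n) | avoids231_word w].

Definition join (l r : seq nat) : seq nat :=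
  l ++ (size l + size r) :: map (addn (size l)) r.

Lemma avoids231_wordP (w : seq nat) :
  reflect (forall a b c, a < b -> b < c -> c < size w ->
             nth 0 w c < nth 0 w a -> nth 0 w a < nth 0 w b -> False)
    (avoids231_word w).
Proof.
apply: (iffP idP) => [H a b c ab bc cw ca ba|H].
  move/negP: H; apply.
  have bw : b < size w by exact: ltn_trans bc cw.
  have aw : a < size w by exact: ltn_trans ab bw.
  apply/existsP; exists (Ordinal aw); apply/existsP; exists (Ordinal bw).
  by apply/existsP; exists (Ordinal cw); rewrite /= ab bc ca ba.
apply/negP => /existsP [a /existsP [b /existsP [c /and4P [ab bc ca ba]]]].
exact: (H a b c).
Qed.

Lemma mem_words231 (n : nat) (w : seq nat) :
  (w \in words231 n) = avoids231_word w && perm_eq w (iota 0 n).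
Proof. by rewrite mem_filter mem_permutations. Qed.

Lemma words231_uniq (n : nat) : uniq (words231 n).
Proof. by rewrite filter_uniq // permutations_uniq. Qed.

Lemma words231_0 : words231 0 = [:: [::]].
Proof.
apply: perm_small_eq => //; apply: uniq_perm; rewrite ?words231_uniq // => w.
rewrite mem_words231 inE; apply/andP/eqP => [[_ /perm_size /size0nil //]|->].
by split => //; apply/avoids231_wordP => a b [|c].
Qed.

Lemma words231_size (n : nat) (w : seq nat) : w \in words231 n -> size w = n.
Proof. by rewrite mem_words231 => /andP[_ /perm_size]; rewrite size_iota. Qed.

Lemma words231_lt (n : nat) (w : seq nat) (x : nat) :
  w \in words231 n -> (x \in w) = (x < n).
Proof. by rewrite mem_words231 => /andP[_ /perm_mem ->]; rewrite mem_iota. Qed.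

Lemma words231_nth_lt (n : nat) (w : seq nat) (i : nat) :
  w \in words231 n -> i < n -> nth 0 w i < n.
Proof.
move=> wn ilt; rewrite -(words231_lt _ wn) mem_nth //.
by rewrite (words231_size wn).
Qed.

(** * Decomposition of a 231-avoiding word at its maximum *)

Lemma nth_join (l r : seq nat) (i : nat) : i < (size l + size r).+1 ->
  nth 0 (join l r) i =
    if i < size l then nth 0 l i
    else if i == size l then size l + size r
    else size l + nth 0 r (i - size l).-1.
Proof.
move=> ile; rewrite /join nth_cat; case: ltnP => // lei.
case: eqP => [->|/eqP ne]; first by rewrite subnn.
have -> : i - size l = (i - size l).-1.+1 by lia.
rewrite /= (nth_map 0) //; lia.
Qed.

Lemma perm_eq_iotaS (n : nat) (l s : seq nat) :
  perm_eq (l ++ n :: s) (iota 0 n.+1) = perm_eq (l ++ s) (iota 0 n).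
Proof.
by rewrite -addn1 iotaD -cat1s perm_catCA perm_sym perm_catC perm_cons perm_sym.
Qed.

(** The last letter of a 231 pattern is below its first, so a pattern cannot start in [l] and end
    outside [l]. It cannot start at the maximum either, hence it lies within one block. *)
Lemma join_words231 (k m : nat) (l r : seq nat) :
  l \in words231 k -> r \in words231 m -> join l r \in words231 (k + m).+1.
Proof.
move=> lk rm; have sl := words231_size lk; have sr := words231_size rm.
have lltk := words231_nth_lt (i := _) lk; have rltm := words231_nth_lt (i := _) rm.
move: (lk) (rm); rewrite !mem_words231 => /andP[/avoids231_wordP al pl].
move=> /andP[/avoids231_wordP ar pr]; apply/andP; split; last first.
  rewrite /join sl sr perm_eq_iotaS iotaD perm_cat // add0n -[in iota k m](addn0 k).
  by rewrite iotaDl perm_map.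
apply/avoids231_wordP => a b c ab bc.
rewrite {1}/join size_cat /= size_map sl sr => cw.
rewrite !nth_join ?sl ?sr; try lia.
have := rltm (c - k).-1; have := rltm (a - k).-1; have := rltm (b - k).-1.
have := lltk a; have := lltk b; have := lltk c.
move=> la lb lc ra rb rc.
case: (ltnP c k) => ck.
  rewrite (ltn_trans bc ck) (ltn_trans ab (ltn_trans bc ck)).
  by apply: al => //; rewrite sl.
case: (ltnP a k) => ak.
  by case: eqP => ?; lia.
have bk : (b < k) = false by lia.
have bk' : (b == k) = false by lia.
have ck' : (c == k) = false by lia.
rewrite bk bk' ck'; case: eqP => ak' H1 H2; first lia.
by apply: (ar (a - k).-1 (b - k).-1 (c - k).-1); lia.
Qed.

Lemma words231_joinP (n : nat) (w : seq nat) : w \in words231 n.+1 ->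
  exists l r, [/\ w = join l r, l \in words231 (size l),
                 r \in words231 (size r) & size l + size r = n].
Proof.
move=> wn; have nw : n \in w by rewrite (words231_lt _ wn).
have [l [s ew]] : exists l s : seq nat, w = l ++ n :: s.
  by case/splitPr: nw => l s; exists l, s.
rewrite {}ew in wn nw *; have := words231_size wn; rewrite size_cat /= => sw.
move: (wn); rewrite mem_words231 => /andP[/avoids231_wordP aw pw].
have pls : perm_eq (l ++ s) (iota 0 n) by rewrite -perm_eq_iotaS.
(* Otherwise [x], the maximum [n] and [y] form a 231 pattern. *)
have lelt x y : x \in l -> y \in s -> x < y.
  move=> xl ys; have us : uniq (l ++ s) by rewrite (perm_uniq pls) iota_uniq.
  have xn : x < n by have := perm_mem pls x; rewrite mem_cat xl mem_iota.
  rewrite ltn_neqAle; apply/andP; split.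
    apply: contraTneq us => exy; rewrite cat_uniq -has_sym.
    by apply/negP => /and3P[_ /hasPn /(_ x xl)]; rewrite /= exy ys.
  rewrite leqNgt; apply/negP => yx.
  have xi : index x l < size l by rewrite index_mem.
  have yi : index y s < size s by rewrite index_mem.
  apply: (aw (index x l) (size l) (size l + (index y s).+1)) => //.
  - by lia.
  - by rewrite size_cat /=; lia.
  - rewrite !nth_cat xi ifN ?addKn /= ?nth_index //; lia.
  - by rewrite !nth_cat xi ltnn subnn /= nth_index.
(* As [l] lies below [s], sorting the two pieces separately already sorts the whole word. Cutting at
   [size l] then identifies the values in each piece. *)
have [pl ps] : perm_eq l (iota 0 (size l)) /\ perm_eq s (iota (size l) (size s)).
  have e : sort leq l ++ sort leq s = iota 0 (size l) ++ iota (size l) (size s).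
    rewrite -[X in iota X (size s)]add0n -iotaD.
    have -> : size l + size s = n by lia.
    apply: (sorted_eq leq_trans anti_leq).
    + rewrite (sorted_pairwise leq_trans) pairwise_cat.
      rewrite -!sorted_pairwise //; try exact: leq_trans.
      rewrite !sort_sorted //; try exact: leq_total.
      rewrite !andbT; apply/allrelP => x y; rewrite !mem_sort => xl ys.
      exact: ltnW (lelt _ _ xl ys).
    + exact: iota_sorted.
    + by apply: perm_trans pls; apply: perm_cat; rewrite perm_sort.
  move/eqP: e; rewrite eqseq_cat ?size_sort ?size_iota // => /andP[/eqP <- /eqP <-].
  by rewrite !(perm_sym _ (sort _ _)) !perm_sort.
pose r := map (subn^~ (size l)) s.
have sr : size r = size s by rewrite size_map.
have rs : map (addn (size l)) r = s.
  rewrite -map_comp map_id_in // => y ys /=; rewrite subnKC //.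
  by have := perm_mem ps y; rewrite ys mem_iota => /esym/andP[].
have nr i : i < size s -> nth 0 s i = size l + nth 0 r i.
  by move=> ils; rewrite -[in LHS]rs (nth_map 0) ?sr.
exists l, r; split.
- rewrite /join sr rs; congr (_ ++ _ :: _); lia.
- rewrite mem_words231 pl andbT; apply/avoids231_wordP => a b c ab bc cl.
  have := aw a b c ab bc; rewrite size_cat !nth_cat cl (ltn_trans bc cl).
  by rewrite (ltn_trans ab (ltn_trans bc cl)) => h *; apply: h => //; lia.
- rewrite mem_words231; apply/andP; split.
    apply/avoids231_wordP => a b c ab bc cr h1 h2.
    apply: (aw (size l + a.+1) (size l + b.+1) (size l + c.+1)); try lia.
    + by rewrite size_cat /=; lia.
    + by rewrite !nth_cat !ifN ?addKn /= ?nr; lia.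
    + by rewrite !nth_cat !ifN ?addKn /= ?nr; lia.
  have /perm_map_inj : injective (addn (size l)) by exact: addnI.
  by apply; rewrite rs -iotaDl addn0 sr.
- by rewrite sr; lia.
Qed.

(** The length of the word gives its maximal letter, and the position of that letter gives
    [size l]. *)
Lemma join_inj (l r l' r' : seq nat) :
  l \in words231 (size l) -> r \in words231 (size r) ->
  l' \in words231 (size l') -> r' \in words231 (size r') ->
  join l r = join l' r' -> l = l' /\ r = r'.
Proof.
move=> wl wr wl' wr' e.
have idx l0 r0 : l0 \in words231 (size l0) ->
    index (size l0 + size r0) (join l0 r0) = size l0.
  move=> w0; rewrite index_cat /= eqxx addn0 ifN //.
  by rewrite (words231_lt _ w0) -leqNgt leq_addr.
have es : size l + size r = size l' + size r'.
  have := congr1 size e; rewrite /join !size_cat /= !size_map; lia.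
have el : size l = size l'.
  by rewrite -(idx l r wl) -(idx l' r' wl') e es.
move/eqP: e; rewrite /join eqseq_cat // eqseq_cons el => /and3P[/eqP -> _ /eqP].
by move/(inj_map (@addnI (size l'))).
Qed.

(** By the preceding lemmas [join] is a bijection. The operation is arbitrary because both natural
    numbers and polynomials are summed this way. *)
Lemma big_words231S (R : Type) (idx : R) (op : Monoid.com_law idx) (n : nat)
    (F : seq nat -> R) :
  \big[op/idx]_(w <- words231 n.+1) F w =
  \big[op/idx]_(k < n.+1) \big[op/idx]_(l <- words231 k)
     \big[op/idx]_(r <- words231 (n - k)) F (join l r).
Proof.
pose t k := [seq (l, r) | l <- words231 k, r <- words231 (n - k)].
pose s := [seq join p.1 p.2 | k <- iota 0 n.+1, p <- t k].
have -> : \big[op/idx]_(w <- words231 n.+1) F w = \big[op/idx]_(w <- s) F w.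
  apply/perm_big/uniq_perm; first exact: words231_uniq.
    apply: allpairs_uniq_dep => [|k _|].
    - exact: iota_uniq.
    - by apply: allpairs_uniq; rewrite ?words231_uniq // => -[? ?] [? ?] _ _.
    have tP := @allpairsPdep _ (fun=> (seq nat * seq nat)%type : eqType) _ _ _ t.
    move=> x y /tP[k [_ [_ /allpairsP[[l r] [lk rk ->]] ->]]].
    move=> /tP[k' [_ [_ /allpairsP[[l' r'] [/= lk' rk' ->]] ->]]] /=.
    have := words231_size lk; have := words231_size rk.
    have := words231_size lk'; have := words231_size rk' => er' el' er el.
    rewrite -er in rk; rewrite -er' in rk'; subst k k'.
    by move=> /join_inj[] // -> ->.
  move=> w; apply/idP/allpairsPdep.
    move=> /words231_joinP[l [r [-> wl wr e]]].
    exists (size l), (l, r); split => //; first by rewrite mem_iota; lia.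
    by apply/allpairsP; exists (l, r); split; rewrite /= -?e ?addKn.
  move=> [k [p [kn /allpairsP[[l r] [/= lk rk ->]] ->]]] /=.
  have -> : n = k + (n - k) by move: kn; rewrite mem_iota; lia.
  exact: join_words231.
rewrite big_allpairs_dep -[iota 0 n.+1]/(index_iota 0 n.+1) big_mkord.
by apply: eq_bigr => k _; rewrite big_allpairs_dep.
Qed.

Lemma sum_words231S (n : nat) (F : seq nat -> nat) :
  \sum_(w <- words231 n.+1) F w =
  \sum_(w <- words231 n) F (join w [::]) +
  \sum_(k < n) \sum_(l <- words231 k) \sum_(r <- words231 (n - k)) F (join l r).
Proof.
rewrite big_words231S big_ord_recr /= subnn words231_0 addnC; congr (_ + _).
by apply: eq_bigr => l _; rewrite big_seq1.
Qed.

(** * Descents and drops of a joined word *)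

Lemma des_from_cat (x : nat) (s1 s2 : seq nat) :
  des_from x (s1 ++ s2) = des_from x s1 + des_from (last x s1) s2.
Proof. by elim: s1 x => //= y s1 IH x; rewrite IH addnA. Qed.

Lemma des_from_addn (k x : nat) (s : seq nat) :
  des_from (k + x) (map (addn k) s) = des_from x s.
Proof. by elim: s x => //= y s IH x; rewrite IH ltn_add2l. Qed.

Lemma maxdrop_from_cat (p : nat) (s1 s2 : seq nat) :
  maxdrop_from p (s1 ++ s2) = maxn (maxdrop_from p s1) (maxdrop_from (p + size s1) s2).
Proof.
elim: s1 p => [|y s1 IH] p /=; first by rewrite max0n addn0.
by rewrite IH maxnA addSnnS.
Qed.

Lemma maxdrop_from_addn (k p : nat) (s : seq nat) :
  maxdrop_from (k + p) (map (addn k) s) = maxdrop_from p s.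
Proof. by elim: s p => //= y s IH p; rewrite subnDl -addnS IH. Qed.

Lemma predn_maxdrop_from (p : nat) (s : seq nat) : (maxdrop_from p.+1 s).-1 = maxdrop_from p s.
Proof. by elim: s p => //= y s IH p; rewrite -(IH p.+1); lia. Qed.

Lemma leq_maxdrop_from (p i : nat) (s : seq nat) :
  i < size s -> p + i - nth 0 s i <= maxdrop_from p s.
Proof.
elim: s p i => // y s IH p [|i] /= il; first by rewrite addn0 leq_maxl.
by rewrite leq_max addnS -addSn IH ?orbT.
Qed.

(** The last letter is at most [n], so after the shift its drop is at least 1. The maximum is
    therefore positive, and the predecessor in [predn_maxdrop_from] loses nothing. *)
Lemma maxdrop_from1 (n : nat) (w : seq nat) : w \in words231 n.+1 ->
  maxdrop_from 1 w = (wmaxdrop w).+1.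
Proof.
move=> wn; have nw := words231_nth_lt wn (ltnSn n).
have := @leq_maxdrop_from 1 n w; rewrite (words231_size wn) -(predn_maxdrop_from 0).
by move=> /(_ (ltnSn n)); lia.
Qed.

Lemma wdes_join0 (l : seq nat) (n : nat) : l \in words231 n ->
  wdes (join l [::]) = wdes l.
Proof.
move=> ln; rewrite /join addn0 des_from_cat /= addn0.
case: ltnP => //; last by rewrite addn0.
case/lastP: l ln => [|l x] // ln; rewrite last_rcons.
have := words231_lt x ln; rewrite (words231_size ln) mem_rcons inE eqxx /=.
by move/esym; lia.
Qed.

Lemma wdes_join (l r : seq nat) (k m : nat) :
  l \in words231 k -> r \in words231 m.+1 -> wdes (join l r) = (wdes l + wdes r).+1.
Proof.
move=> lk rm; have sl := words231_size lk; have sr := words231_size rm.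
rewrite /join des_from_cat /=.
have -> : (size l + size r < last 0 l) = false.
  case/lastP: l lk sl => [|l x] // lk sl; rewrite last_rcons.
  have := words231_lt x lk; rewrite mem_rcons inE eqxx /= => /esym; lia.
have := words231_nth_lt rm (ltn0Sn m); case: r rm sr => // y r rm /= sr ylt.
have -> : size l + y < size l + (size r).+1 by lia.
by rewrite des_from_addn add0n add1n addnS.
Qed.

Lemma wmaxdrop_join0 (l : seq nat) : wmaxdrop (join l [::]) = wmaxdrop l.
Proof. by rewrite /join maxdrop_from_cat /= add0n addn0 subnn maxnn maxn0. Qed.

(** The letters of [r] move by [size l + 1] positions but only by [size l] in value, which raises
    the maximal drop by one. *)
Lemma wmaxdrop_join (l r : seq nat) (m : nat) : r \in words231 m.+1 ->
  wmaxdrop (join l r) = maxn (wmaxdrop l) (wmaxdrop r).+1.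
Proof.
move=> rm; rewrite /join maxdrop_from_cat /= -(maxdrop_from1 rm) -(maxdrop_from_addn (size l) 1).
rewrite add0n addn1; congr maxn; lia.
Qed.

Lemma leq_wmaxdrop_wdes (n : nat) (w : seq nat) : w \in words231 n -> wmaxdrop w <= wdes w.
Proof.
move: w; have [m] := ubnP n; elim: m n => // m IH [|n] nm w.
  by rewrite words231_0 inE => /eqP ->.
move=> /words231_joinP[l [r [-> lk rk e]]].
have hl : wmaxdrop l <= wdes l by apply: IH lk; lia.
case: r rk e => [|x r] rk e; first by rewrite wmaxdrop_join0 (wdes_join0 lk).
have hr : wmaxdrop (x :: r) <= wdes (x :: r) by apply: IH rk; lia.
by rewrite (wmaxdrop_join l rk) (wdes_join lk rk); lia.
Qed.

(** * From permutations to words in one-line notation *)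

Definition word n (s : 'S_n) : seq nat := [seq (s i : nat) | i <- enum 'I_n].

Lemma size_word n (s : 'S_n) : size (word s) = n.
Proof. by rewrite size_map size_enum_ord. Qed.

Lemma nth_word n (s : 'S_n) (i : 'I_n) : nth 0 (word s) i = s i.
Proof. by rewrite (nth_map i) ?size_enum_ord // nth_ord_enum. Qed.

Lemma word_inj n : injective (@word n).
Proof. by move=> s t e; apply/permP => i; apply: val_inj; rewrite /= -!nth_word e. Qed.

Lemma perm_word n (s : 'S_n) : perm_eq (word s) (iota 0 n).
Proof.
rewrite -val_enum_ord /word (map_comp val s) perm_map //.
apply: uniq_perm; rewrite ?(map_inj_uniq (@perm_inj _ s)) ?enum_uniq //.
by move=> i; rewrite mem_enum -[i](permKV s) map_f // mem_enum.
Qed.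

Lemma avoids231_word_of n (s : 'S_n) : avoids231_word (word s) = avoids231 s.
Proof.
apply/avoids231_wordP/idP => [H|].
  apply/negP => /existsP [a /existsP [b /existsP [c /and4P [ab bc ca ba]]]].
  by apply: (H a b c) => //; rewrite ?size_word // !nth_word.
move/negP => H a b c ab bc cn; rewrite size_word in cn => ca ba; apply: H.
have bn := ltn_trans bc cn; have an := ltn_trans ab bn.
apply/existsP; exists (Ordinal an); apply/existsP; exists (Ordinal bn).
by apply/existsP; exists (Ordinal cn); rewrite -!nth_word /= ab bc ca ba.
Qed.

Lemma words231P n (w : seq nat) :
  reflect (exists2 s : 'S_n, avoids231 s & w = word s) (w \in words231 n).
Proof.
apply: (iffP idP) => [wn|[s av ->]]; last first.
  by rewrite mem_words231 avoids231_word_of av perm_word.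
have sw := words231_size wn.
pose f (i : 'I_n) : 'I_n := Ordinal (words231_nth_lt wn (ltn_ord i)).
have f_inj : injective f.
  move=> i j /(congr1 val) /= /eqP; rewrite nth_uniq ?sw // => [/eqP/val_inj //|].
  by have := wn; rewrite mem_words231 => /andP[_ /perm_uniq ->]; exact: iota_uniq.
have e : w = word (perm f_inj).
  apply: (@eq_from_nth _ 0) => [|i]; rewrite ?size_word sw // => ilt.
  by rewrite (nth_word _ (Ordinal ilt)) permE.
exists (perm f_inj) => //; rewrite -avoids231_word_of -e.
by have := wn; rewrite mem_words231 => /andP[].
Qed.

Lemma card_avoids231 n (P : pred (seq nat)) :
  #|[set s : 'S_n | avoids231 s && P (word s)]| = count P (words231 n).
Proof.
rewrite cardE -(size_map (@word n)) -size_filter; apply/perm_size/uniq_perm.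
- by rewrite map_inj_uniq ?enum_uniq //; exact: word_inj.
- by rewrite filter_uniq // words231_uniq.
move=> w; rewrite mem_filter; apply/mapP/andP => [[s]|[Pw /words231P[s av e]]].
  by rewrite mem_enum inE => /andP[av Ps] ->; split => //; apply/words231P; exists s.
by exists s; rewrite // mem_enum inE av -e.
Qed.

Lemma des_fromE (x : nat) (w : seq nat) :
  des_from x w = \sum_(i < size w) (nth 0 w i < nth 0 (x :: w) i).
Proof. by elim: w x => [|y w IH] x; rewrite /= ?big_ord0 // big_ord_recl IH. Qed.

Lemma maxdrop_fromE (p : nat) (w : seq nat) :
  maxdrop_from p w = \max_(i < size w) (p + i - nth 0 w i).
Proof.
elim: w p => [|y w IH] p; rewrite /= ?big_ord0 // big_ord_recl IH /= addn0.
by congr maxn; apply: eq_bigr => i _; rewrite addSnnS.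
Qed.

Lemma des_word n (s : 'S_n) : des s = wdes (word s).
Proof.
rewrite des_fromE size_word /des -sum1dep_card big_mkcond /=.
case: n s => [|n] s; first by rewrite !big_ord0.
(* [des] indexes a descent by its first position, [des_from] by its second. The last term on the
   left and the first on the right vanish, and the others match after a shift. *)
rewrite big_ord_recr [RHS]big_ord_recl /= add0n addnC.
case: existsP => [[i' /andP[]]|_]; first by have := ltn_ord i'; lia.
rewrite add0n; apply: eq_bigr => i _; rewrite add0n.
rewrite (nth_word s (lift ord0 i)) (nth_word s (widen_ord (leqnSn n) i)).
case: existsP => [[i' /andP[/eqP ei' lt]]|H].
  by have -> : lift ord0 i = i' by [apply: val_inj; rewrite /= ei']; rewrite lt.
by case: ltnP => // lt; case: H; exists (lift ord0 i); rewrite lt andbT.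
Qed.

Lemma maxdrop_word n (s : 'S_n) : maxdrop s = wmaxdrop (word s).
Proof.
by rewrite maxdrop_fromE size_word; apply: eq_bigr => i _; rewrite nth_word.
Qed.

(** * Recurrences for the joint distribution *)

Lemma wmaxdrop_gt0 (n : nat) (w : seq nat) :
  w \in words231 n -> 0 < wdes w -> 0 < wmaxdrop w.
Proof.
elim: n w => [|n IH] w; first by rewrite words231_0 inE => /eqP ->.
move=> /words231_joinP[l [r [-> lk rk e]]].
case: r rk e => [|x r] rk e; last by rewrite (wmaxdrop_join l rk) leq_max orbT.
rewrite wmaxdrop_join0 (wdes_join0 lk).
by apply: IH; rewrite -e addn0.
Qed.

Definition count_dh (d h n : nat) : nat :=
  count (fun w => (wdes w == d) && (wmaxdrop w == h)) (words231 n).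

Lemma sum_nat_count (T : Type) (p : pred T) (s : seq T) :
  \sum_(x <- s) p x = count p s.
Proof. by rewrite -sum1_count [RHS]big_mkcond; apply: eq_bigr => x _; case: (p x). Qed.

Lemma sum_count_mul (T : Type) (p q : pred T) (s t : seq T) :
  \sum_(x <- s) \sum_(y <- t) p x * q y = count p s * count q t.
Proof. by rewrite -!sum_nat_count big_distrlr. Qed.

Lemma sum_count_dhS (f : nat -> nat -> nat) (n : nat) :
  \sum_(w <- words231 n.+1) f (wdes w) (wmaxdrop w) =
  \sum_(w <- words231 n) f (wdes w) (wmaxdrop w) +
  \sum_(k < n) \sum_(l <- words231 k) \sum_(r <- words231 (n - k))
     f (wdes l + wdes r).+1 (maxn (wmaxdrop l) (wmaxdrop r).+1).
Proof.
rewrite sum_words231S; congr (_ + _).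
  by apply: eq_big_seq => w wn; rewrite (wdes_join0 wn) wmaxdrop_join0.
apply: eq_bigr => k _; apply: eq_big_seq => l lk; apply: eq_big_seq => r rk.
have kn : n - k = (n - k).-1.+1 by have := ltn_ord k; lia.
by rewrite kn in rk; rewrite (wdes_join lk rk) (wmaxdrop_join l rk).
Qed.

Lemma count_dhE (d h n : nat) :
  count_dh d h n = \sum_(w <- words231 n) ((wdes w == d) && (wmaxdrop w == h)).
Proof. by rewrite sum_nat_count. Qed.

(** If [r] is nonempty, des exceeds the maxdrop of [l], so equality must come from [r]. This forces
    [l] to have no descent and [r] to have equal statistics. *)
Lemma count_dhSS (j n : nat) :
  count_dh j.+1 j.+1 n.+1 =
  count_dh j.+1 j.+1 n + \sum_(k < n) count_dh 0 0 k * count_dh j j (n - k).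
Proof.
rewrite !count_dhE (sum_count_dhS (fun d h => (d == j.+1) && (h == j.+1))).
congr (_ + _); apply: eq_bigr => k _; rewrite -sum_count_mul.
apply: eq_big_seq => l lk; apply: eq_big_seq => r rk.
have := leq_wmaxdrop_wdes lk; have := leq_wmaxdrop_wdes rk.
rewrite -mulnb -!mulnb.
by do !case: eqP => //=; lia.
Qed.

(** Defect one leaves three cases: [l] has no descent and [r] has defect one; [l] has one descent
    and [r] has defect zero; or [l] attains the maximum and [r] has no descent. For [j = 0] the last
    two coincide, hence the factor [0 < j]. *)
Lemma count_dh_succS (j n : nat) :
  count_dh j.+2 j.+1 n.+1 =
  count_dh j.+2 j.+1 n +
  (\sum_(k < n) count_dh 0 0 k * count_dh j.+1 j (n - k) +
   \sum_(k < n) count_dh 1 1 k * count_dh j j (n - k) +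
   (0 < j) * \sum_(k < n) count_dh j.+1 j.+1 k * count_dh 0 0 (n - k)).
Proof.
rewrite !count_dhE (sum_count_dhS (fun d h => (d == j.+2) && (h == j.+1))).
congr (_ + _); rewrite big_distrr -!big_split; apply: eq_bigr => k _ /=.
rewrite -!sum_count_mul big_distrr -!big_split; apply: eq_big_seq => l lk /=.
rewrite big_distrr -!big_split; apply: eq_big_seq => r rk /=.
have := wmaxdrop_gt0 lk; have := leq_wmaxdrop_wdes lk.
have := wmaxdrop_gt0 rk; have := leq_wmaxdrop_wdes rk.
move: (wdes l) (wmaxdrop l) (wdes r) (wmaxdrop r) => a b c d dc cd ba ab.
(* The cases [a = 0], [a = 1] and [a >= 2] correspond to the three sums, in this order. *)
case: a ba ab => [|[|a]] ba ab.
- have -> : b = 0 by lia.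
  by rewrite max0n; do !case: eqP => //=; lia.
- have -> : b = 1 by lia.
  by case: j => [|j] /=; do !case: eqP => //=; lia.
have -> : (0 < j) * (((a.+2 == j.+1) && (b == j.+1)) * ((c == 0) && (d == 0))) =
    [&& a.+2 == j.+1, b == j.+1 & c == 0].
  case: j => [|j]; case: c cd dc => [|c] // cd dc; rewrite ?andbF //= ?muln0 //.
  by do !case: eqP => //=; lia.
by do !case: eqP => //=; lia.
Qed.

Lemma count_dh_00 (n : nat) : count_dh 0 0 n = 1.
Proof.
elim: n => [|n IH]; first by rewrite /count_dh words231_0.
rewrite -[RHS]addn0 -[in RHS]IH !count_dhE.
rewrite (sum_count_dhS (fun d h => (d == 0) && (h == 0))); congr (_ + _).
by rewrite big1 // => k _; rewrite big1 // => l _; rewrite big1.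
Qed.

Lemma count_dh_10 (n : nat) : count_dh 1 0 n = 0.
Proof.
rewrite count_dhE big_seq big1 // => w /wmaxdrop_gt0.
by case: eqP => // -> /(_ isT); case: (wmaxdrop w).
Qed.

(** * Binomial convolutions and closed forms *)

Lemma sum_bin_bin (N a b : nat) :
  \sum_(k < N.+1) 'C(k, a) * 'C(N - k, b) = 'C(N.+1, a + b + 1).
Proof.
(* Combinatorially, [k] is the element of rank [a + 1] in a subset of [{0, ..., N}] of size
   [a + b + 1]. The induction applies Pascal's rule to the first factor. *)
elim: a N => [|a IHa] N.
  rewrite add0n addn1; elim: N => [|N IH].
    by rewrite big_ord1 bin0 mul1n subnn binS (bin_small (ltn0Sn b)).
  rewrite big_ord_recl binS -IH addnC bin0 mul1n subn0; congr (_ + _).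
  by apply: eq_bigr => k _; rewrite !bin0.
elim: N => [|N IH]; first by rewrite big_ord_recl big_ord0 mul0n bin_small //; lia.
rewrite big_ord_recl bin0n mul0n add0n.
under eq_bigr => k _ do rewrite /= /bump add1n binS subSS mulnDl.
by rewrite big_split /= IH IHa !addSn binS.
Qed.

(** The full convolution runs over [k < n + i]. For [k >= n] the second upper index is below
    [i <= b], so the extra terms vanish. *)
Lemma sum_bin_bin_trunc (n a i b : nat) : i <= b ->
  \sum_(k < n) 'C(k, a) * 'C((n - k + i).-1, b) = 'C(n + i, a + b + 1).
Proof.
case: n => [|n] ib; first by rewrite big_ord0 bin_small //; lia.
rewrite addSn -sum_bin_bin -addSn big_split_ord /= [X in _ = _ + X]big1 ?addn0.
  by apply: eq_bigr => k _; congr (_ * 'C(_, _)); have := ltn_ord k; lia.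
move=> k _; rewrite [X in _ * X]bin_small ?muln0 //; have := ltn_ord k; lia.
Qed.

Lemma sum_bin_trunc (n i b : nat) : i <= b ->
  \sum_(k < n) 'C((n - k + i).-1, b) = 'C(n + i, b.+1).
Proof.
move=> ib; rewrite -addn1 -[b + 1]add0n addnA -sum_bin_bin_trunc //.
by apply: eq_bigr => k _; rewrite bin0 mul1n.
Qed.

Lemma count_dh_diag (j n : nat) : count_dh j j n = 'C((n + j).-1, 2 * j).
Proof.
elim: j n => [|j IHj] n; first by rewrite count_dh_00 bin0.
elim: n => [|n IH].
  by rewrite bin_small ?/count_dh ?words231_0 //=; lia.
rewrite count_dhSS IH.
under eq_bigr => k _ do rewrite count_dh_00 IHj mul1n.
rewrite sum_bin_trunc; last by lia.
have -> : (n.+1 + j.+1).-1 = (n + j).+1 by lia.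
have -> : (n + j.+1).-1 = n + j by lia.
by rewrite mulnS binS.
Qed.

(** When [j] increases by one, the first sum of the recurrence carries over the factor [2 * j + 1],
    and each of the other two adds one copy of the same binomial. For [j = 0] only the second sum
    survives. *)
Lemma count_dh_subdiag (j n : nat) :
  count_dh j.+2 j.+1 n = (2 * j + 1) * 'C(n + j, 2 * j + 4).
Proof.
elim: j n => [|j IHj] n; (elim: n => [|n IH];
  first by rewrite bin_small ?muln0 ?/count_dh ?words231_0 //=; lia);
rewrite count_dh_succS {}IH.
  rewrite mul0n addn0 big1 ?add0n => [|k _]; last by rewrite count_dh_10 muln0.
  under eq_bigr => k _ do rewrite !count_dh_diag addn1 muln1 /=.
  by rewrite sum_bin_bin_trunc // !addn0 !mul1n binS.
rewrite mul1n.
have e1 : \sum_(k < n) 'C((n - k + j.+1).-1, (2 * j + 4)) = 'C(n + j.+1, 2 * j + 5).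
  by rewrite sum_bin_trunc ?addnS //; lia.
have -> : \sum_(k < n) count_dh 0 0 k * count_dh j.+2 j.+1 (n - k) =
    (2 * j + 1) * 'C(n + j.+1, 2 * j + 5).
  rewrite -e1 big_distrr; apply: eq_bigr => k _.
  rewrite count_dh_00 IHj mul1n; congr (_ * 'C(_, _)); lia.
have -> : \sum_(k < n) count_dh j.+2 j.+2 k * count_dh 0 0 (n - k) =
    'C(n + j.+1, 2 * j + 5).
  (* Reversing the order of summation lets the block with drops be the right one, as in [e1]. *)
  rewrite -e1 (reindex_inj rev_ord_inj); apply: eq_bigr => k _ /=.
  rewrite count_dh_00 muln1 count_dh_diag; have := ltn_ord k => kn.
  by congr 'C(_, _); lia.
under eq_bigr => k _ do rewrite !count_dh_diag addn1 muln1 /=.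
rewrite sum_bin_bin_trunc; last by lia.
have -> : 2 + 2 * j.+1 + 1 = 2 * j + 5 by lia.
have -> : 2 * j.+1 + 4 = (2 * j + 5).+1 by lia.
by rewrite addSn binS; lia.
Qed.

(** * Descent polynomials and the Narayana distribution *)

Section DescentPolynomials.

Local Open Scope ring_scope.

Definition descent_poly (n : nat) : {poly rat} :=
  \sum_(w <- words231 n) 'X^(wdes w).

Lemma coef_descent_poly (n d : nat) :
  (descent_poly n)`_d = (count (fun w => wdes w == d) (words231 n))%:R.
Proof.
rewrite coef_sum -sum_nat_count natr_sum; apply: eq_bigr => w _.
by rewrite coefXn eq_sym.
Qed.

Lemma descent_poly0 : descent_poly 0 = 1.
Proof. by rewrite /descent_poly words231_0 big_seq1. Qed.

(** The summand [k = n] stands for an empty right block, which creates no descent. It is removed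
    from the multiple of ['X] and counted separately. *)
Lemma descent_polyS (n : nat) :
  descent_poly n.+1 = descent_poly n
    + 'X * (\sum_(k < n.+1) descent_poly k * descent_poly (n - k) - descent_poly n).
Proof.
rewrite /descent_poly big_words231S /= !big_ord_recr /= subnn words231_0.
rewrite addrC; congr (_ + _).
  apply: eq_big_seq => l ln; rewrite big_seq1.
  by rewrite (wdes_join0 ln).
rewrite big_seq1 mulr1 addrK big_distrr; apply: eq_bigr => k _ /=.
rewrite big_distrlr big_distrr; apply: eq_big_seq => l lk.
rewrite big_distrr; apply: eq_big_seq => r rk /=.
have kn : (n - k = (n - k).-1.+1)%N by have := ltn_ord k; lia.
by rewrite kn in rk; rewrite (wdes_join lk rk) exprS exprD.
Qed.

(* The truncation of the generating function T of the descent polynomials,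
   which satisfies T = 1 + x T + x y T (T - 1). *)
Definition descent_gf (N : nat) : {poly {poly rat}} := \poly_(n < N) descent_poly n.

(** Multiplying the equation of T by [T ^+ m] makes it linear in the powers of T. The bound on [n]
    keeps the truncation invisible. *)
Lemma coef_descent_gf_expS (N m n : nat) : (n.+1 < N)%N ->
  let T := descent_gf N in
  (T ^+ m.+1)`_n.+1 =
  (T ^+ m)`_n.+1 + (T ^+ m.+1)`_n + 'X * ((T ^+ m.+2)`_n - (T ^+ m.+1)`_n).
Proof.
move=> nN T.
have T0 : T`_0 = 1 by rewrite coef_poly (ltn_trans _ nN) // descent_poly0.
have TS k : (k <= n)%N -> T`_k.+1 = (T + ('X : {poly rat})%:P * (T * T - T))`_k.
  move=> kn; rewrite coefD coefCM coefB coefM !coef_poly.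
  have -> : (k.+1 < N)%N by lia.
  have -> : (k < N)%N by lia.
  rewrite descent_polyS; congr (_ + _ * (_ - _)); apply: eq_bigr => i _.
  by rewrite !coef_poly; have := ltn_ord i => ik; rewrite !ifT //; lia.
rewrite exprS coefM big_ord_recl T0 mul1r subn0 -addrA; congr (_ + _).
transitivity (((T + ('X : {poly rat})%:P * (T * T - T)) * T ^+ m)`_n).
  rewrite coefM; apply: eq_bigr => k _.
  by rewrite /= subSS TS //; have := ltn_ord k; lia.
rewrite mulrDl -exprS coefD -mulrA coefCM mulrBl coefB -mulrA.
by rewrite -!exprS.
Qed.

Lemma natr_mul_bin_left (n k : nat) :
  k.+1%:R * 'C(n, k.+1)%:R = (n%:R - k%:R) * 'C(n, k)%:R :> rat.
Proof.
have [kn|nk] := leqP k n; first by rewrite -natrB // -!natrM mul_bin_left.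
by rewrite !bin_small ?mulr0 //; lia.
Qed.

(** Here [u], [v] stand for the binomials of [n] over [d] and [d - 1], and [p], [q] for those of
    [n + m] over [m + d] and [m + d + 1]. The last two hypotheses are the ratios of neighbours. *)
Lemma narayana_step (m n d u v p q : rat) : n != 0 -> n + 1 != 0 ->
  d * u = (n - d + 1) * v -> (m + 1 + d) * q = (n - d) * p ->
  (m + 1) / (n + 1) * (u + v) * (p + q) =
  m / (n + 1) * (u + v) * p + (m + 1) / n * u * q
   + ((m + 2) / n * v * (p + q) - (m + 1) / n * v * p).
Proof.
move=> n0 n1 huv hpq.
apply/eqP; rewrite -subr_eq0; apply/eqP.
(* The difference of the two sides is a combination of the two ratio relations. *)
have -> : (m + 1) / (n + 1) * (u + v) * (p + q) -
  (m / (n + 1) * (u + v) * p + (m + 1) / n * u * q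
   + ((m + 2) / n * v * (p + q) - (m + 1) / n * v * p)) =
  ((p + q) * (d * u - (n - d + 1) * v) - (u + v) * ((m + 1 + d) * q - (n - d) * p)) / (n * (n + 1)).
  by field; rewrite n0 n1.
by rewrite huv hpq !subrr !mulr0 subrr mul0r.
Qed.

(* The right-hand side is Lagrange inversion for T = 1 + u with
   u = x (1 + u) (1 + y u); the linear recurrence above determines it. *)
Lemma coef_descent_gf_exp (N m n d : nat) : (0 < n < N)%N ->
  ((descent_gf N ^+ m)`_n)`_d =
  m%:R / n%:R * 'C(n, d)%:R * 'C((n + m).-1, m + d)%:R.
Proof.
case: n => // n; set T := descent_gf N; rewrite andTb.
have T0 k : (0 < N)%N -> (T ^+ k)`_0 = 1.
  move=> N0; elim: k => [|k IH]; first by rewrite expr0 coef1.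
  by rewrite exprS coefM big_ord1 IH mulr1 coef_poly N0 descent_poly0.
(* The recurrence uses exponent [m] in the same degree, and exponents [m + 1] and [m + 2] one degree
   lower. Hence the outer induction is on the degree, for all [m]. *)
elim: n m d => [|n IHn] m d nN; elim: m d => [|m IHm] d;
  try by rewrite expr0 coef1 coef0 !mul0r.
  rewrite coef_descent_gf_expS // !T0 ?(ltnW nN) // subrr mulr0 addr0 coefD IHm.
  rewrite coef1 !divr1 add1n /=.
  case: d => [|d]; first by rewrite !bin0 !addn0 !binn !mulr1 -natr1.
  by rewrite (@bin_small m) ?(@bin_small m.+1) ?mulr0 ?addr0 //; lia.
rewrite coef_descent_gf_expS // !coefD IHm IHn ?(ltnW nN) // coefXM.
have eS1 : m.+1%:R = m%:R + 1 :> rat by rewrite natr1.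
have eS2 : m.+2%:R = m%:R + 2 :> rat by rewrite -addn2 natrD.
(* The binomial with lower index [d - 1], set to 0 at [d = 0], where the truncated index would give
   1. *)
pose v := if d is d'.+1 then 'C(n.+1, d')%:R else 0 : rat.
have -> : (if d == 0%N then 0 else ((T ^+ m.+2)`_n.+1 - (T ^+ m.+1)`_n.+1)`_d.-1) =
    (m%:R + 2) / n.+1%:R * v * ('C((n + m).+1, m + d)%:R + 'C((n + m).+1, (m + d).+1)%:R)
    - (m%:R + 1) / n.+1%:R * v * 'C((n + m).+1, m + d)%:R.
  rewrite /v; case: d {IHm v} => [|d] /=; first by rewrite !mulr0 !mul0r subrr.
  rewrite coefB !IHn ?(ltnW nN) //.
  have -> : (n.+1 + m.+2).-1 = (n + m).+2 by lia.
  have -> : (n.+1 + m.+1).-1 = (n + m).+1 by lia.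
  have -> : (m.+2 + d = (m + d.+1).+1)%N by lia.
  have -> : (m.+1 + d = m + d.+1)%N by lia.
  by rewrite binS natrD eS2 eS1 [X in _ * X - _]addrC.
have -> : (n.+2 + m.+1).-1 = (n + m).+2 by lia.
have -> : (n.+2 + m).-1 = (n + m).+1 by lia.
have -> : (n.+1 + m.+1).-1 = (n + m).+1 by lia.
have -> : 'C(n.+2, d)%:R = 'C(n.+1, d)%:R + v.
  by rewrite /v; case: d {IHm v} => [|d]; rewrite ?bin0 ?addr0 // binS natrD.
rewrite !addSn [in RHS]binS [in RHS]natrD [X in _ = _ * X]addrC eS1 -[n.+2%:R]natr1.
apply/esym/(narayana_step (d := d%:R)).
- by rewrite pnatr_eq0.
- by rewrite natr1 pnatr_eq0.
- rewrite /v; case: d {IHm v} => [|d]; first by rewrite mul0r mulr0.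
  by rewrite natr_mul_bin_left -[d.+1]addn1 natrD opprD addrA subrK.
- have -> : m%:R + 1 + d%:R = (m + d).+1%:R :> rat by rewrite natr1 -natrD.
  rewrite natr_mul_bin_left -[(n + m).+1]addSn !natrD.
  by congr (_ * _); ring.
Qed.

(** The first power, [m = 1], of the closed form: these are the Narayana numbers. Truncating at
    [n.+1] just keeps degree [n]. *)
Lemma count_wdes (n d : nat) : (0 < n)%N ->
  (count (fun w => wdes w == d) (words231 n))%:R
    = 1 / n%:R * 'C(n, d)%:R * 'C(n, d + 1)%:R :> rat.
Proof.
move=> n0; rewrite -coef_descent_poly.
have := @coef_descent_gf_exp n.+1 1 n d; rewrite n0 ltnSn => /(_ isT).
by rewrite expr1 coef_poly ltnSn addn1 add1n addn1.
Qed.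

End DescentPolynomials.

(** * Transfer of the counts to permutations *)

Lemma card_des_maxdrop (n d h : nat) :
  #|[set s : 'S_n | [&& avoids231 s, des s == d & maxdrop s == h]]| = count_dh d h n.
Proof.
rewrite /count_dh -card_avoids231; apply: eq_card => s.
by rewrite !inE des_word maxdrop_word.
Qed.

Theorem theorem15 (n j : nat) (n_ge1 : 1 <= n) (j_ge2 : 2 <= j) :
  #|[set s : 'S_n | [&& avoids231 s, des s == j & maxdrop s == j - 1]]|
    = (2 * j - 3) * 'C(n + j - 2, 2 * j)
  /\
  (#|[set s : 'S_n | [&& avoids231 s, des s == j & maxdrop s <= j - 2]]|%N%:R
    = 1 / n%:R * 'C(n, j)%N%:R * 'C(n, j + 1)%N%:R
      - 'C(n + j - 1, 2 * j)%N%:R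
      - ((2 * j - 3) * 'C(n + j - 2, 2 * j))%N%:R :> rat)%R.
Proof.
have eB : count_dh j (j - 1) n = (2 * j - 3) * 'C(n + j - 2, 2 * j).
  case: j j_ge2 => [|[|i]] // _; rewrite subSS subn0 count_dh_subdiag.
  by congr (_ * 'C(_, _)); lia.
split; first by rewrite card_des_maxdrop.
rewrite -count_wdes // -eB subn1 -count_dh_diag.
have -> : #|[set s : 'S_n | [&& avoids231 s, des s == j & maxdrop s <= j - 2]]| =
    count (fun w => (wdes w == j) && (wmaxdrop w <= j - 2)) (words231 n).
  rewrite -card_avoids231; apply: eq_card => s.
  by rewrite !inE des_word maxdrop_word.
(* As maxdrop is at most des, the bound [j - 2] excludes only the values [j - 1] and [j]. *)
have -> : count (fun w => wdes w == j) (words231 n) =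
    count (fun w => (wdes w == j) && (wmaxdrop w <= j - 2)) (words231 n)
      + count_dh j (j - 1) n + count_dh j j n.
  rewrite /count_dh -!sum_nat_count -!big_split; apply: eq_big_seq => w wn /=.
  have := leq_wmaxdrop_wdes wn; case: eqP => //= ->.
  by do !case: eqP; lia.
by rewrite !natrD addrK addrK.
Qed.
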